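(* (i) For every $n\in\mathbb{N}$, $$E_n^{\text{park}}X_n^{\text{LR-max}}=n-\sum_{l=1}^n\frac{n-l}{l(l+1)}\,\frac{\prod_{j=0}^{l-1}(n-j)}{(n+1)^l}.$$ (ii) For any $\epsilon>0$, $$\limsup_{n\to\infty}\frac{E_n^{\text{park}}X_n^{\text{LR-max}}}{n^{\frac12+\epsilon}}=0,$$ and $$\liminf_{n\to\infty}\frac{E_n^{\text{park}}X_n^{\text{LR-max}}}{n^{\frac12}}>0.$$
   Context: $[n]=\{1,\dots,n\}$ and $S_n$ is the set of permutations $\sigma=\sigma_1\cdots\sigma_n$ of $[n]$. Parking: cars $1,\dots,n$ arrive in this order on a one-way street with spaces $1,\dots,n$; given a sequence $\pi=(\pi_1,\dots,\pi_n)\in[n]^n$ of preferred spaces, car $i$ parks in space $\pi_i$ if it is free, and otherwise in the first free space with number greater than $\pi_i$, if one exists (if none exists the car exits the street). $\pi$ is a parking function on $[n]$ if all $n$ cars are able to park; $\mathcal{P}_n$ is the set of parking functions on $[n]$. The map $T_n:\mathcal{P}_n\to S_n$ is $T_n(\pi)=\sigma$, where $\sigma_j$ is the number of the car that parked in space $j$, $j\in[n]$. The probability measure $P_n^{\text{park}}$ on $S_n$ is $P_n^{\text{park}}(\sigma)=|T_n^{-1}(\{\sigma\})|/|\mathcal{P}_n|$, and $E_n^{\text{park}}$ is the corresponding expectation. A position $i\in[n]$ is a left-to-right maximum for $\sigma\in S_n$ if $\sigma_i>\sigma_k$ for all $k\in[i-1]$. $X_n^{\text{LR-max}}(\sigma)$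 is the total number of left-to-right maxima in $\sigma$. *)

(* Defs.v *)
From HB Require Import structures.
From mathcomp Require Import all_boot all_order all_algebra all_fingroup.
From mathcomp Require Import all_classical all_reals all_analysis.

Set Implicit Arguments.
Unset Strict Implicit.
Unset Printing Implicit Defensive.

Import Order.TTheory GRing.Theory Num.Theory.

Local Open Scope ring_scope.

(* Cars, spaces and positions 1, ..., n are represented by the
   elements 0, ..., n - 1 of 'I_n. *)

Definition preferences (n : nat) := {ffun 'I_n -> 'I_n}.

(* [Some i] in space j: car i is parked there; [None]: the space is free. *)
Definition street (n : nat) := {ffun 'I_n -> option 'I_n}.

(* [enum 'I_n] is increasing, so the head of the filtered list is the first
   free space numbered at least the preferred one; if the list is empty, the
   car exits. *)
Definition arrive (n : nat) (p : preferences n) (s : street n) (i : 'I_n) :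
    street n :=
  if [seq j : 'I_n <- enum 'I_n | (p i <= j)%N && (s j == None)] is j :: _
  then [ffun k => if k == j then Some i else s k] else s.

Definition final_street (n : nat) (p : preferences n) : street n :=
  foldl (arrive p) [ffun=> None] (enum 'I_n).

Definition is_parking (n : nat) (p : preferences n) : bool :=
  [forall i, exists j, final_street p j == Some i].

Definition parking_function (n : nat) := {p : preferences n | is_parking p}.

(* When p is a parking function no space is left free, so the default value
   of [odflt] is never used. *)
Definition car_in (n : nat) (p : preferences n) (j : 'I_n) : 'I_n :=
  odflt j (final_street p j).

Lemma car_in_inj (n : nat) (p : parking_function n) : injective (car_in (val p)).
Proof.
have /forallP /= h := valP p.
have hs i : exists j, car_in (val p) j == i.
  by have /existsP [j /eqP hj] := h i; exists j; rewrite /car_in hj.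
pose g i := xchoose (hs i).
have gK : cancel g (car_in (val p)) by move=> i; apply/eqP/(xchooseP (hs i)).
exact: (bij_inj (bij_can_bij (injF_bij (can_inj gK)) gK)).
Qed.

Definition T_park (n : nat) (p : parking_function n) : 'S_n :=
  perm (@car_in_inj n p).

Lemma T_parkE (n : nat) (p : parking_function n) (j : 'I_n) :
  final_street (val p) j = Some (T_park p j).
Proof.
have /forallP /(_ (T_park p j)) /existsP [k /eqP hk] := valP p.
suff e : k = j by rewrite -{1}e.
by apply: (@car_in_inj n p); rewrite {1}/car_in hk /= permE.
Qed.

Definition P_park (R : realType) (n : nat) (sigma : 'S_n) : R :=
  #|[set p : parking_function n | T_park p == sigma]|%:R
    / #|{: parking_function n}|%:R.

Definition E_park (R : realType) (n : nat) (X : 'S_n -> R) : R :=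
  \sum_(sigma : 'S_n) X sigma * P_park R sigma.

Definition is_LR_max (n : nat) (sigma : 'S_n) (i : 'I_n) : bool :=
  [forall k : 'I_n, (k < i)%N ==> (sigma k < sigma i)%N].

Definition X_LR_max (n : nat) (sigma : 'S_n) : nat :=
  #|[set i | is_LR_max sigma i]|.

Definition E_park_LR_max (R : realType) (n : nat) : R :=
  E_park (fun sigma : 'S_n => (X_LR_max sigma)%:R).

(* Main.v *)
Require Import Defs.
From HB Require Import structures.
From mathcomp Require Import all_boot all_order all_algebra all_fingroup.
From mathcomp Require Import all_classical all_reals all_analysis.
From mathcomp Require Import ring lra zify.

(** Fix an outcome sigma.  The car parked in space j ends there exactly when its
    preferred space a satisfies a <= j and the spaces a, ..., j - 1 are held by
    earlier cars ([final_snapshot]).  These choices are independent, so the fiber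
    of sigma has as many elements as the product over j of the lengths of the
    longest runs ending at j all of whose entries are at most sigma j
    ([card_fiber]).

    This product behaves well when a word is cut at its maximum M: the weight of
    u ++ M :: v is (weight of u) * (size u + 1) * (weight of v), and its left-to-right
    maxima are those of u together with M.  Hence, with P_n the total weight and
    A_n the total weight counted with left-to-right maxima,
      P_(n+1) = sum_k C(n,k) (k+1) P_k P_(n-k),
      A_(n+1) = P_(n+1) + sum_k C(n,k) (k+1) A_k P_(n-k).
    Abel's identity solves the first by P_n = (n+1)^(n-1).  Through the tree function
    T = x exp T, the second says that the exponential generating function of A is
    exp T * log (1 / (1 - T)); expanding it by Lagrange inversion gives
      A_n / P_n = sum_(1 <= m <= n) (1 + 1/m) q_m,   q_m = n^_m / (n+1)^m,
    which is [mean_records].  That this solves the recurrence is checked directly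
    ([parking_mean_records_rec]), Abel's identity playing the part of the generating
    functions.

    The rest follows from one relation, q_m - q_(m+1) = q_m (m+1) / (n+1).  Summation
    by parts turns [mean_records] into the expression of the theorem
    ([mean_recordsE]).  With M the integer part of sqrt n, bounding the terms up to M by
    1 and telescoping the others gives sum_m q_m <= M + (n+1)/(M+1), while the terms
    up to M are at least 1/4; so the mean lies between sqrt n / 8 and 6 sqrt n, and
    both limits follow. *)

Set Implicit Arguments.
Unset Strict Implicit.
Unset Printing Implicit Defensive.

Import Order.TTheory GRing.Theory Num.Theory.

Local Open Scope ring_scope.

(** * Cutting the arrangements of a set at one of its elements *)

Lemma cat_cons_inj (T : eqType) (x : T) (u u' v v' : seq T) :
  x \notin u -> x \notin u' -> u ++ x :: v = u' ++ x :: v' -> u = u' /\ v = v'.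
Proof.
move=> xu xu' e.
have szu : size u = size u'.
  have := congr1 (index x) e.
  by rewrite !index_cat (negPf xu) (negPf xu') /= eqxx !addn0.
by move/eqP: e; rewrite eqseq_cat // eqseq_cons eqxx => /andP[/eqP -> /eqP ->].
Qed.

Lemma perm_enum_set (T : finType) (A : {set T}) (s : seq T) :
  perm_eq s (enum A) -> [set x in s] = A.
Proof.
by move=> sA; apply/setP=> x; rewrite inE (perm_mem sA) mem_enum.
Qed.

(** An arrangement of S plus the point x is the choice of the set A standing to the
    left of x, an arrangement of A and an arrangement of the rest. *)
Lemma sum_permutations_split (T : finType) (V : nmodType) (x : T) (S : {set T})
    (F : seq T -> V) :
  x \notin S ->
  \sum_(s <- permutations (enum (x |: S))) F s =
  \sum_(A in powerset S) \sum_(u <- permutations (enum A))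
     \sum_(v <- permutations (enum (S :\: A))) F (u ++ x :: v).
Proof.
move=> xS.
pose t (A : {set T}) := [seq (u, v) | u <- permutations (enum A),
                                      v <- permutations (enum (S :\: A))].
pose h (A : {set T}) (uv : seq T * seq T) := uv.1 ++ x :: uv.2.
have tP (A : {set T}) (uv : seq T * seq T) :
    reflect (perm_eq uv.1 (enum A) /\ perm_eq uv.2 (enum (S :\: A)))
            (uv \in t A).
  apply: (iffP allpairsP) => [[[u v] [/= + + ->]]|[uA vA]].
    by rewrite !mem_permutations.
  by exists uv; rewrite !mem_permutations; split=> //; case: (uv).
have xA (A : {set T}) u : A \subset S -> perm_eq u (enum A) -> x \notin u.
  by move=> /fintype.subsetP AS /perm_mem ->; rewrite mem_enum; apply: contra xS => /AS.
have perm_h : perm_eq (permutations (enum (x |: S)))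
                      [seq h A uv | A <- enum (powerset S), uv <- t A].
  apply: uniq_perm => [||s]; first exact: permutations_uniq.
    apply: allpairs_uniq_dep; first exact: enum_uniq.
      move=> A _; apply: allpairs_uniq; try exact: permutations_uniq.
      by move=> [? ?] [? ?] _ _ [-> ->].
    move=> _ _ /allpairsPdep[A [uv [AS uvA ->]]] /allpairsPdep[B [wz [BS wzB ->]]].
    rewrite /= /h; move: AS BS; rewrite !mem_enum !powersetE => AS BS.
    have [[uA _] [wB _]] := (tP _ _ uvA, tP _ _ wzB).
    move/cat_cons_inj=> /(_ (xA _ _ AS uA) (xA _ _ BS wB)) [euw evz].
    have eAB : A = B by rewrite -(perm_enum_set uA) euw (perm_enum_set wB).
    rewrite eAB; congr (Tagged _ _).
    by case: uv wz euw evz {uvA wzB uA wB} => [? ?] [? ?] /= -> ->.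
  rewrite mem_permutations; apply/idP/allpairsPdep => [sS|[A [uv [+ + ->]]]].
    have us : uniq s by rewrite (perm_uniq sS) enum_uniq.
    have xs : x \in s by rewrite (perm_mem sS) mem_enum setU11.
    case/splitPr: xs sS us => u v sS us.
    have [ux vx uv] : [/\ x \notin u, x \notin v & forall y, y \in u -> y \notin v].
      move: us; rewrite cat_uniq /= => /and3P[_ /norP[ux /hasPn uv] /andP[vx _]].
      by split=> // y yu; apply/negP => /uv; rewrite /= yu.
    have memS y : (y \in S) = (y \in u) || (y \in v).
      have := perm_mem sS y; rewrite mem_enum in_setU1 mem_cat inE.
      case: (eqVneq y x) => [->|_] /=; last by move<-.
      by rewrite (negPf xS) (negPf ux) (negPf vx).
    exists [set y in u], (u, v); rewrite mem_enum powersetE; split=> //.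
      by apply/fintype.subsetP => y; rewrite inE memS => ->.
    move: us; rewrite cat_uniq /= => /and3P[uu _ /andP[_ uv']].
    apply/tP; split; apply: uniq_perm => //=; rewrite ?enum_uniq // => y.
      by rewrite mem_enum inE.
    rewrite mem_enum !inE memS; have := uv y.
    by case: (y \in u) (y \in v) => [] [] // /(_ isT).
  rewrite mem_enum powersetE => AS /tP[uA vA].
  have S_A : perm_eq (uv.1 ++ uv.2) (enum S).
    apply: (perm_trans (perm_cat uA vA)); apply: uniq_perm; last 1 first.
    - move=> y; rewrite mem_cat !mem_enum inE.
      by case: (boolP (y \in A)) => //= /(fintype.subsetP AS).
    - rewrite cat_uniq !enum_uniq andbT; apply/hasPn => y.
      by rewrite /= !mem_enum inE => /andP[].
    - exact: enum_uniq.
  rewrite /h (perm_catCA _ [:: x] _); apply: perm_trans (_ : perm_eq (x :: enum S) _).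
    by rewrite /= perm_cons.
  apply: uniq_perm; rewrite /= ?enum_uniq ?mem_enum ?andbT // => y.
  by rewrite inE !mem_enum !inE.
rewrite (perm_big _ perm_h) big_allpairs_dep big_enum /=.
by apply: eq_bigr => A _; rewrite big_allpairs.
Qed.

Lemma sum_subsets_by_card (R : pzSemiRingType) (T : finType) (S : {set T})
    (G : nat -> R) :
  \sum_(A in powerset S) G #|A| = \sum_(k < #|S|.+1) 'C(#|S|, k)%:R * G k.
Proof.
rewrite (partition_big (fun A : {set T} => inord #|A| : 'I_#|S|.+1) xpredT) //=.
apply: eq_bigr => k _; rewrite mulr_natl -cards_draws -sumr_const.
apply: eq_big => [A|A /andP[]].
  rewrite powersetE inE; case: (boolP (A \subset S)) => //= AS.
  by rewrite -val_eqE /= inordK // ltnS subset_leq_card.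
rewrite powersetE => AS /eqP <-.
by rewrite inordK // ltnS subset_leq_card.
Qed.

(** * Run lengths and records of words *)

(** The suffixes of t below x are nested and include the empty one, so their number
    is one plus the length of the longest: when x comes right after t, it is the
    length of the longest run ending at x with no entry above x. *)
Fixpoint suffixes_below n (x : 'I_n) (t : seq 'I_n) : nat :=
  all (fun y : 'I_n => y < x)%N t
  + (if t is _ :: t' then suffixes_below x t' else 0).

(** In [run_weight] and [records], pre is the part of the word already read; this
    makes both functions split along concatenations. *)
Fixpoint run_weight n (pre s : seq 'I_n) : nat :=
  if s is x :: s' then (suffixes_below x pre * run_weight (rcons pre x) s')%N
  else 1.

Fixpoint records n (pre s : seq 'I_n) : nat :=
  if s is x :: s' then
    (all (fun y : 'I_n => y < x)%N pre + records (rcons pre x) s')%N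
  else 0.

Lemma suffixes_below_all n (x : 'I_n) t :
  all (fun y : 'I_n => y < x)%N t -> suffixes_below x t = (size t).+1.
Proof. by elim: t => //= y t IH /andP[-> tx]; rewrite tx IH. Qed.

Lemma suffixes_below_cat n (x M : 'I_n) u v :
  (x < M)%N -> suffixes_below x (u ++ M :: v) = suffixes_below x v.
Proof.
move=> xM; have nMx : (M < x)%N = false by rewrite ltnNge ltnW.
by elim: u => [|y u IH] /=; rewrite ?nMx // all_cat /= nMx !andbF.
Qed.

Lemma run_weight_cat n (pre u v : seq 'I_n) :
  run_weight pre (u ++ v) = (run_weight pre u * run_weight (pre ++ u) v)%N.
Proof.
elim: u pre => [|x u IH] pre; first by rewrite cats0 mul1n.
by rewrite /= IH mulnA -cats1 -catA.
Qed.

Lemma records_cat n (pre u v : seq 'I_n) :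
  records pre (u ++ v) = (records pre u + records (pre ++ u) v)%N.
Proof.
elim: u pre => [|x u IH] pre; first by rewrite cats0.
by rewrite /= IH addnA -cats1 -catA.
Qed.

(** No run of an entry smaller than M extends past M to the left, so what precedes M
    is invisible to the entries after it. *)
Lemma run_weight_after n (M : 'I_n) (u pre v : seq 'I_n) :
  all (fun y : 'I_n => y < M)%N v ->
  run_weight (u ++ M :: pre) v = run_weight pre v.
Proof.
elim: v pre => //= x v IH pre /andP[xM vM].
by rewrite suffixes_below_cat // rcons_cat rcons_cons IH.
Qed.

Lemma records_after n (M : 'I_n) (u pre v : seq 'I_n) :
  all (fun y : 'I_n => y < M)%N v -> records (u ++ M :: pre) v = 0%N.
Proof.
elim: v pre => //= x v IH pre /andP[xM vM].
by rewrite rcons_cat rcons_cons IH // all_cat /= ltnNge ltnW // !andbF.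
Qed.

Lemma run_weight_split n (M : 'I_n) (u v : seq 'I_n) :
  all (fun y : 'I_n => y < M)%N u -> all (fun y : 'I_n => y < M)%N v ->
  run_weight [::] (u ++ M :: v) =
    (run_weight [::] u * (size u).+1 * run_weight [::] v)%N.
Proof.
move=> uM vM; rewrite run_weight_cat /= suffixes_below_all // -mulnA.
by rewrite -cats1 run_weight_after.
Qed.

Lemma records_split n (M : 'I_n) (u v : seq 'I_n) :
  all (fun y : 'I_n => y < M)%N u -> all (fun y : 'I_n => y < M)%N v ->
  records [::] (u ++ M :: v) = (records [::] u).+1.
Proof.
move=> uM vM; rewrite records_cat /= uM -cats1 records_after //.
by rewrite addn0 addn1.
Qed.

Lemma suffixes_belowE n (x : 'I_n) t :
  suffixes_below x t =
  (\sum_(a < (size t).+1) all (fun y : 'I_n => (y < x)%N) (drop a t))%N.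
Proof.
elim: t => [|y t IH]; first by rewrite big_ord1.
by rewrite big_ord_recl /= IH.
Qed.

Lemma run_weightE n (x0 : 'I_n) (pre s : seq 'I_n) :
  run_weight pre s =
  (\prod_(j < size s) suffixes_below (nth x0 s j) (pre ++ take j s))%N.
Proof.
elim: s pre => [|x s IH] pre; first by rewrite big_ord0.
rewrite big_ord_recl /= cats0 IH; congr muln.
by apply: eq_bigr => j _; rewrite -cats1 -catA.
Qed.

Lemma recordsE n (x0 : 'I_n) (pre s : seq 'I_n) :
  records pre s =
  (\sum_(j < size s)
     all (fun y : 'I_n => (y < nth x0 s j)%N) (pre ++ take j s))%N.
Proof.
elim: s pre => [|x s IH] pre; first by rewrite big_ord0.
rewrite big_ord_recl /= cats0 IH; congr addn.
by apply: eq_bigr => j _; rewrite -cats1 -catA.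
Qed.

(** * Abel's identity and the solution of the recurrences *)

Lemma mul_bin_bin n k m :
  (m <= k <= n)%N -> ('C(n, k) * 'C(k, m) = 'C(n, m) * 'C(n - m, k - m))%N.
Proof.
move=> /andP[mk kn].
have mn := leq_trans mk kn.
have fact_neq0 : (0 < m`! * (k - m)`! * (n - k)`!)%N by rewrite !muln_gt0 !fact_gt0.
apply/eqP; rewrite -(eqn_pmul2r fact_neq0); apply/eqP.
have e1 := bin_fact kn; have e2 := bin_fact mk; have e3 := bin_fact mn.
have e4 : ('C(n - m, k - m) * ((k - m)`! * (n - k)`!) = (n - m)`!)%N.
  by rewrite -(@bin_fact (n - m) (k - m)) ?leq_sub2r // subnBA // subnK.
transitivity n`!.
  rewrite -e1 -e2; ring.
rewrite -e3 -e4; ring.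
Qed.

Section AbelIdentity.
Variable R : numFieldType.
Implicit Types (x a : R).

(** The n-th finite difference of a polynomial of degree d < n vanishes.  The
    induction on d splits off a factor a - k, whose term in k is absorbed by
    k C(n,k) = n C(n-1,k-1). *)
Lemma alternating_binomial_sum (n d : nat) a : (d < n)%N ->
  \sum_(0 <= k < n.+1) (-1) ^+ k * 'C(n, k)%:R * (a - k%:R) ^+ d = 0.
Proof.
elim: d n a => [|d IH] n a dn.
  under eq_bigr do rewrite expr0 mulr1.
  have := exprBn (1 : R) 1 n; rewrite subrr expr0n (gtn_eqF dn) => /esym e0.
  rewrite -[RHS]e0 big_mkord; apply: eq_bigr => i _.
  by rewrite !expr1n !mulr1 mulr_natr.
case: n dn => // n dn.
have split k : (-1) ^+ k * 'C(n.+1, k)%:R * (a - k%:R) ^+ d.+1 =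
    a * ((-1) ^+ k * 'C(n.+1, k)%:R * (a - k%:R) ^+ d)
    - (-1) ^+ k * (k * 'C(n.+1, k))%:R * (a - k%:R) ^+ d :> R.
  rewrite exprS natrM; ring.
under eq_bigr do rewrite split.
rewrite sumrB -mulr_sumr IH; last by rewrite ltnW.
rewrite mulr0 sub0r big_nat_recl //= mul0n mulr0 mul0r add0r.
rewrite -[LHS]mul1r; apply/eqP; rewrite mulrN -mulNr; apply/eqP.
have shift k : (-1) ^+ k.+1 * (k.+1 * 'C(n.+1, k.+1))%:R * (a - k.+1%:R) ^+ d =
    - n.+1%:R * ((-1) ^+ k * 'C(n, k)%:R * ((a - 1) - k%:R) ^+ d) :> R.
  rewrite -mul_bin_diag natrM exprS -(natr1 k).
  have -> : a - (k%:R + 1) = a - 1 - k%:R by ring.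
  ring.
under eq_bigr do rewrite shift.
by rewrite -mulr_sumr IH ?mulr0.
Qed.

(** The number (n+1)^(n-1) of parking functions, written as a quotient so that
    the exponent is also right at n = 0. *)
Definition parking_count (n : nat) : R := n.+1%:R ^+ n / n.+1%:R.

(** Put y = x + n + 1 and write x + k = y - (n - k + 1).  In the binomial expansion,
    the coefficient of y^j is, for j < n, an (n - j)-th difference of a power of degree
    n - j - 1, hence zero; only y^n survives. *)
Lemma abel_identity (n : nat) x :
  \sum_(0 <= k < n.+1) 'C(n, k)%:R * parking_count (n - k) * (x + k%:R) ^+ k =
  (x + n.+1%:R) ^+ n.
Proof.
pose y := x + n.+1%:R.
pose b k : R := (n - k).+1%:R.
have b0 k : b k != 0 by rewrite pnatr_eq0.
have expand k : (k < n.+1)%N -> (x + k%:R) ^+ k =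
    \sum_(0 <= j < n.+1) 'C(k, j)%:R * y ^+ j * (- b k) ^+ (k - j).
  move=> kn; have -> : x + k%:R = - b k + y.
    by rewrite /b /y -!natr1 natrB //; ring.
  rewrite exprDn (big_cat_nat (n := k.+1)) //= [X in _ + X]big1_seq ?addr0; last first.
    move=> j /=; rewrite mem_index_iota => /andP[kj _].
    by rewrite bin_small // !mul0r.
  rewrite big_mkord; apply: eq_bigr => j _.
  by rewrite -mulr_natl; ring.
under eq_big_nat => k /andP[_ kn] do rewrite expand // mulr_sumr.
rewrite exchange_big_nat /= big_nat_recr //= [X in X + _]big1_seq ?add0r.
  rewrite big_nat_recr //= big1_seq ?add0r; last first.
    move=> k /=; rewrite mem_index_iota => /andP[_ kn].
    by rewrite (bin_small kn) !(mul0r, mulr0).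
  by rewrite /parking_count binn subnn expr0 divr1 !mul1r mulr1.
move=> j /=; rewrite mem_index_iota => /andP[_ jn].
rewrite (big_cat_nat (n := j)) //=; last exact: ltnW (ltnW _).
rewrite [X in X + _]big1_seq ?add0r; last first.
  move=> k /=; rewrite mem_index_iota => /andP[_ kj].
  by rewrite (bin_small kj) !(mul0r, mulr0).
rewrite -{1}[j]add0n big_addn subSn; last exact: ltnW.
have term i : (i < (n - j).+1)%N ->
    'C(n, i + j)%:R * parking_count (n - (i + j)) *
      ('C(i + j, j)%:R * y ^+ j * (- b (i + j)%N) ^+ (i + j - j)) =
    'C(n, j)%:R * y ^+ j *
      ((-1) ^+ i * 'C(n - j, i)%:R * ((n - j).+1%:R - i%:R) ^+ (n - j).-1).
  rewrite ltnS => ij.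
  have ijn : (i + j <= n)%N by lia.
  have cc : 'C(n, i + j)%:R * 'C(i + j, j)%:R =
            'C(n, j)%:R * 'C(n - j, i)%:R :> R.
    by rewrite -!natrM mul_bin_bin ?leq_addl // addnK.
  have -> : (n - j).+1%:R - i%:R = b (i + j)%N.
    by rewrite /b -!natr1 !natrB ?natrD //; [ring|exact: ltnW].
  have eb : parking_count (n - (i + j)) * b (i + j)%N ^+ i = b (i + j)%N ^+ (n - j).-1.
    apply: (mulIf (b0 (i + j)%N)); rewrite /parking_count -/(b (i + j)%N).
    rewrite -exprSr prednK ?subn_gt0 // mulrAC mulfVK // -exprD.
    by congr (_ ^+ _); lia.
  rewrite [in LHS]exprNn addnK.
  transitivity ('C(n, i + j)%:R * 'C(i + j, j)%:R * y ^+ j * (-1) ^+ i *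
     (parking_count (n - (i + j)) * b (i + j)%N ^+ i)); first by ring.
  by rewrite eb cc; ring.
under eq_big_nat => i /andP[_ ij] do rewrite term //.
rewrite -mulr_sumr alternating_binomial_sum ?mulr0 //.
by rewrite prednK ?subn_gt0.
Qed.

Lemma natr_ffactS (n m : nat) :
  (n ^_ m.+1)%:R = (n ^_ m)%:R * (n%:R - m%:R) :> R.
Proof.
rewrite ffactnSr natrM; case: (leqP m n) => [mn|nm]; first by rewrite natrB.
by rewrite ffact_small // !mul0r.
Qed.

(** Abel's identity at x = m + 1: the falling factorial of k combines with C(n,k)
    into C(n-m,k-m), which shifts the summation by m. *)
Lemma abel_identity_ffact (n m : nat) : (m <= n)%N ->
  \sum_(0 <= k < n.+1) 'C(n, k)%:R * parking_count (n - k) *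
      ((k ^_ m)%:R * (k.+1%:R ^+ k / k.+1%:R ^+ m)) =
  (n ^_ m)%:R * n.+2%:R ^+ (n - m).
Proof.
move=> mn; rewrite (big_cat_nat (n := m)) //=; last exact: leqW.
rewrite [X in X + _]big1_seq ?add0r; last first.
  move=> k /=; rewrite mem_index_iota => /andP[_ km].
  by rewrite ffact_small // !(mul0r, mulr0).
rewrite -{1}[m]add0n big_addn subSn //.
have -> : n.+2%:R = m.+1%:R + (n - m).+1%:R :> R.
  by rewrite -natrD; congr (_%:R); lia.
rewrite -abel_identity mulr_sumr; apply: eq_big_nat => i /andP[_].
rewrite ltnS => im.
have imn : (i + m <= n)%N by lia.
have cc : 'C(n, i + m)%:R * ((i + m) ^_ m)%:R =
          (n ^_ m)%:R * 'C(n - m, i)%:R :> R.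
  rewrite -!natrM -!bin_ffact mulnA mul_bin_bin ?leq_addl //.
  by rewrite addnK mulnAC.
have -> : (n - m - i)%N = (n - (i + m))%N by lia.
have -> : m.+1%:R + i%:R = (i + m).+1%:R :> R.
  by rewrite -natrD; congr (_%:R); lia.
by rewrite exprD mulfK ?expf_neq0 ?pnatr_eq0 // mulrACA cc; ring.
Qed.

Definition ffact_ratio (n m : nat) : R := (n ^_ m)%:R / n.+1%:R ^+ m.

(** The closed form of A_n / P_n read off from the generating function
    exp T * log (1 / (1 - T)). *)
Definition mean_records (n : nat) : R :=
  \sum_(1 <= m < n.+1) (m%:R + 1) / m%:R * ffact_ratio n m.

(** The case m = 0 of [abel_identity_ffact]. *)
Lemma parking_count_rec (n : nat) :
  parking_count n.+1 =
  \sum_(0 <= k < n.+1)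
     'C(n, k)%:R * (k.+1%:R * parking_count k * parking_count (n - k)).
Proof.
have := abel_identity_ffact (leq0n n); rewrite mul1r subn0 => e.
rewrite /parking_count exprSr mulfK ?pnatr_eq0 // -e.
apply: eq_big_nat => k _; rewrite expr0 divr1 mul1r.
rewrite [_.+1%:R * _]mulrC -/(parking_count k) /parking_count mulfVK ?pnatr_eq0 //.
by ring.
Qed.

(** [abel_identity_ffact] evaluates the sum over k for each index m of
    [mean_records].  Comparing term by term with [mean_records] at n + 1 leaves, by
    (n+1)^_m - n^_m = m n^_(m-1), a sum equal to 1 by telescoping. *)
Lemma parking_mean_records_rec (n : nat) :
  parking_count n.+1 * mean_records n.+1 =
  parking_count n.+1 +
  \sum_(0 <= k < n.+1)
     'C(n, k)%:R * (k.+1%:R * (parking_count k * mean_records k)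
                    * parking_count (n - k)).
Proof.
have nz k : k.+1%:R != 0 :> R by rewrite pnatr_eq0.
(* The terms with m > k vanish, so all means can be summed over the same m. *)
have widen k : (k < n.+1)%N -> mean_records k =
    \sum_(1 <= m < n.+1) (m%:R + 1) / m%:R * ffact_ratio k m.
  move=> kn; rewrite /mean_records [RHS](big_cat_nat (n := k.+1)) //=.
  rewrite [X in _ + X]big1_seq ?addr0 // => m /=.
  rewrite mem_index_iota => /andP[km _].
  by rewrite /ffact_ratio ffact_small // mul0r mulr0.
have -> : \sum_(0 <= k < n.+1) 'C(n, k)%:R *
      (k.+1%:R * (parking_count k * mean_records k) * parking_count (n - k)) =
    \sum_(1 <= m < n.+1) (m%:R + 1) / m%:R * ((n ^_ m)%:R * n.+2%:R ^+ (n - m)).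
  transitivity (\sum_(0 <= k < n.+1) \sum_(1 <= m < n.+1) (m%:R + 1) / m%:R *
      ('C(n, k)%:R * parking_count (n - k) *
        ((k ^_ m)%:R * (k.+1%:R ^+ k / k.+1%:R ^+ m)))).
    apply: eq_big_nat => k /andP[_ kn]; rewrite widen // !(mulr_sumr, mulr_suml).
    apply: eq_bigr => m _; rewrite /ffact_ratio.
    have pk : k.+1%:R * parking_count k = k.+1%:R ^+ k by rewrite mulrC mulfVK.
    by rewrite -pk; move: (m%:R^-1) => c; move: (_ ^-1) => d; ring.
  rewrite exchange_big_nat /=; apply: eq_big_nat => m /andP[m0 mn].
  by rewrite -mulr_sumr abel_identity_ffact.
pose g i : R := (n ^_ i)%:R / n.+2%:R ^+ i.
have tele : \sum_(0 <= i < n.+1) (i%:R + 2) * (n ^_ i)%:R / n.+2%:R ^+ i.+1 = 1 :> R.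
  transitivity (\sum_(0 <= i < n.+1) - (g i.+1 - g i)).
    apply: eq_bigr => i _; rewrite /g natr_ffactS.
    have -> : n%:R = n.+2%:R - 2 :> R by rewrite -(natrB _ (_ : 2 <= n.+2)%N) // subn2.
    have := nz n.+1; move: (n.+2%:R) => z z0; rewrite !exprS.
    by field; rewrite z0 expf_neq0.
  rewrite sumrN telescope_sumr // /g ffact_small // mul0r sub0r opprK.
  by rewrite ffactn0 expr0 divr1.
have ratio_split m : (0 < m)%N -> (m%:R + 1) / m%:R * ffact_ratio n.+1 m =
    (m%:R + 1) / m%:R * g m + (m%:R + 1) * (n ^_ m.-1)%:R / n.+2%:R ^+ m.
  case: m => // m _; rewrite /ffact_ratio /g /=.
  rewrite ffactSS natrM natr_ffactS.
  have := nz m; have /(expf_neq0 m.+1) := nz n.+1.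
  rewrite -(natr1 n) -(natr1 m).
  move: (_ ^+ _) m%:R n%:R => z a b z0 a0.
  by field; rewrite a0 z0.
rewrite /mean_records /parking_count exprSr mulfK //.
rewrite (eq_big_nat _ _ (fun m h => ratio_split m (proj1 (andP h)))) big_split /=.
rewrite [X in _ * (_ + X)]big_add1 /=.
have -> : \sum_(0 <= i < n.+1) (i.+1%:R + 1) * (n ^_ i)%:R / n.+2%:R ^+ i.+1 = 1 :> R.
  by rewrite -[RHS]tele; apply: eq_bigr => i _; rewrite natr1 -natrD addn2.
rewrite mulrDr mulr1 addrC; congr (_ + _).
rewrite big_nat_recr //= /g ffact_small // mul0r mulr0 addr0 mulr_sumr.
apply: eq_big_nat => m /andP[_]; rewrite ltnS => mn.
have := nz n.+1; move: (n.+2%:R) => z z0.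
have -> : z ^+ n = z ^+ (n - m) * z ^+ m by rewrite -exprD subnK.
have := expf_neq0 m z0; move: (z ^+ m) => w w0.
by move: (m%:R^-1) => c; field.
Qed.

End AbelIdentity.

(** * The weighted sums over all arrangements *)

(** Cutting at the maximum turns both sums into the recurrences solved by
    [parking_count] and [mean_records].  They depend on S through its cardinality only,
    which is what the induction needs for the two sides of the cut. *)
Lemma sum_run_weight (R : numFieldType) n (S : {set 'I_n}) :
  \sum_(s <- permutations (enum S)) (run_weight [::] s)%:R =
    parking_count R #|S| /\
  \sum_(s <- permutations (enum S))
     (records [::] s)%:R * (run_weight [::] s)%:R =
    parking_count R #|S| * mean_records R #|S|.
Proof.
have [N leN] := ubnP #|S|; elim: N S leN => // N IH S /ltnSE leN.
have [->|[x xS]] := set_0Vmem S.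
  rewrite cards0 enum_set0 /= !big_seq1 /= /mean_records big_geq //.
  by rewrite /parking_count expr0 divr1 mul0r mulr0.
case: (@arg_maxnP _ x (mem S) (fun i : 'I_n => i : nat) xS) => M /= MS maxM.
have {}MS : M \in S := MS.
rewrite -(finset.setD1K MS); set D := S :\ M.
have MD : M \notin D by rewrite finset.setD11.
have DM y : y \in D -> (y < M)%N.
  rewrite !inE => /andP[yM yS]; rewrite ltn_neqAle -val_eqE in yM *.
  by rewrite yM; exact: maxM.
have leD : (#|D| < N)%N by rewrite (leq_trans _ leN) // (cardsD1 M S) MS.
have below (A : {set 'I_n}) u : A \subset D -> perm_eq u (enum A) ->
    all (fun y : 'I_n => y < M)%N u /\ size u = #|A|.
  move=> /fintype.subsetP AD uA; split; last by rewrite (perm_size uA) -cardE.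
  by apply/allP => y; rewrite (perm_mem uA) mem_enum => /AD /DM.
have split_A (A : {set 'I_n}) : A \in powerset D ->
    \sum_(u <- permutations (enum A)) \sum_(v <- permutations (enum (D :\: A)))
       (run_weight [::] (u ++ M :: v))%:R =
    #|A|.+1%:R * parking_count R #|A| * parking_count R (#|D| - #|A|) /\
    \sum_(u <- permutations (enum A)) \sum_(v <- permutations (enum (D :\: A)))
       (records [::] (u ++ M :: v))%:R * (run_weight [::] (u ++ M :: v))%:R =
    #|A|.+1%:R * parking_count R #|A| * parking_count R (#|D| - #|A|) +
    #|A|.+1%:R * (parking_count R #|A| * mean_records R #|A|)
      * parking_count R (#|D| - #|A|).
  rewrite powersetE => AD.
  have BD : D :\: A \subset D by apply: subsetDl.
  have cardB : #|D :\: A| = (#|D| - #|A|)%N by rewrite cardsD (finset.setIidPr AD).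
  have [wA rA] := IH A (leq_ltn_trans (subset_leq_card AD) leD).
  have [wB _] := IH (D :\: A) (leq_ltn_trans (subset_leq_card BD) leD).
  have prod_sums (f g : seq 'I_n -> R) (c : R) (s t : seq (seq 'I_n)) :
      c * (\sum_(u <- s) f u) * (\sum_(v <- t) g v) =
      \sum_(u <- s) \sum_(v <- t) c * f u * g v.
    by rewrite [c * _]mulr_sumr big_distrlr.
  rewrite -cardB -wB -rA -wA !prod_sums -big_split /=.
  split; apply: eq_big_seq => u; rewrite mem_permutations => /(below A u AD) [uM szu].
    apply: eq_big_seq => v.
    rewrite mem_permutations => /(below _ v BD) [vM _].
    by rewrite run_weight_split // szu !natrM; ring.
  rewrite -big_split /=; apply: eq_big_seq => v.
  rewrite mem_permutations => /(below _ v BD) [vM _].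
  by rewrite run_weight_split // records_split // szu !natrM -(natr1 (records _ _)); ring.
have cardS : #|M |: D| = #|D|.+1 by rewrite cardsU1 MD.
rewrite cardS !sum_permutations_split //; split.
  rewrite (eq_bigr _ (fun A h => proj1 (split_A A h))).
  rewrite (sum_subsets_by_card D (fun k => k.+1%:R * parking_count R k *
     parking_count R (#|D| - k))).
  by rewrite parking_count_rec big_mkord.
rewrite (eq_bigr _ (fun A h => proj2 (split_A A h))).
rewrite (sum_subsets_by_card D (fun k => k.+1%:R * parking_count R k *
   parking_count R (#|D| - k) + k.+1%:R * (parking_count R k * mean_records R k)
   * parking_count R (#|D| - k))).
rewrite parking_mean_records_rec [in RHS]parking_count_rec -big_split /= big_mkord.
by apply: eq_bigr => k _; rewrite mulrDr.
Qed.

(** * The fibers of the parking map *)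

Section Fibers.
Variable n : nat.
Implicit Types (p : preferences n) (sigma : 'S_n) (i j : 'I_n).

(** The list in [arrive] is headed by the least index satisfying its condition. *)
Lemma filter_enum_ordP (P : pred 'I_n) j l :
  [seq i <- enum 'I_n | P i] = j :: l ->
  P j /\ forall b : 'I_n, (b < j)%N -> ~~ P b.
Proof.
move=> e; have : j \in [seq i <- enum 'I_n | P i] by rewrite e mem_head.
rewrite mem_filter => /andP[Pj _]; split=> // b bj; apply: contraL (bj) => Pb.
have : b \in [seq i <- enum 'I_n | P i] by rewrite mem_filter Pb mem_enum.
have : sorted (relpre val ltn) (enum 'I_n).
  by rewrite -sorted_map val_enum_ord iota_ltn_sorted.
move/(sorted_filter (fun y x z => @ltn_trans (val y) (val x) (val z)) P).
rewrite e /= => /(order_path_min (fun y x z => @ltn_trans (val y) (val x) (val z))).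
move=> /allP jl; rewrite inE -leqNgt => /orP[/eqP -> //|/jl /= ].
exact: ltnW.
Qed.

Lemma filter_enum_ord (P : pred 'I_n) j :
  P j -> (forall b : 'I_n, (b < j)%N -> ~~ P b) ->
  exists l, [seq i <- enum 'I_n | P i] = j :: l.
Proof.
move=> Pj minj; case e : [seq i <- enum 'I_n | P i] => [|j' l].
  have : j \in [seq i <- enum 'I_n | P i] by rewrite mem_filter Pj mem_enum.
  by rewrite e.
have [Pj' minj'] := filter_enum_ordP e.
exists l; congr (_ :: _); apply/val_inj/anti_leq.
apply/andP; split; rewrite leqNgt.
  exact: contraL (minj' j) Pj.
exact: contraL (minj j') Pj'.
Qed.

(** The only street compatible with the outcome sigma after the first k cars. *)
Definition snapshot sigma (k : nat) : street n :=
  [ffun j => if (sigma j < k)%N then Some (sigma j) else None].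

(** The condition on a preference a for its car to park in space j under the
    outcome sigma: the spaces from a to j - 1 belong to earlier cars. *)
Definition reaches sigma j (a : 'I_n) : bool :=
  (a <= j)%N && [forall b : 'I_n, (a <= b < j)%N ==> (sigma b < sigma j)%N].

Lemma arrive_snapshot p sigma j :
  (arrive p (snapshot sigma (sigma j)) (sigma j) == snapshot sigma (sigma j).+1)
  = reaches sigma j (p (sigma j)).
Proof.
set i := sigma j; set P := fun k : 'I_n =>
  (p i <= k)%N && (snapshot sigma i k == None).
have PE k : P k = (p i <= k)%N && ~~ (sigma k < i)%N.
  by rewrite /P ffunE; case: ifP.
apply/eqP/andP => [|[pj /forallP cond]].
  rewrite /arrive -/P; case e : (seq.filter _ _) => [|j' l].
    by move=> /(congr1 (fun s : street n => s j)); rewrite !ffunE /= ltnn ltnSn.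
  have [Pj' minj'] := filter_enum_ordP e.
  move=> /(congr1 (fun s : street n => s j')); rewrite !ffunE eqxx; case: ifP => // _ [].
  move=> /perm_inj ejj'; rewrite -{}ejj' in Pj' minj' *.
  move: Pj'; rewrite -/(P j) PE => /andP[pj _]; split=> //.
  apply/forallP => b; apply/implyP => /andP[pb bj].
  by have := minj' b bj; rewrite -/(P b) PE pb negbK.
have [|b bj|l e] := @filter_enum_ord P j.
- by rewrite PE pj ltnn.
- by rewrite PE negb_and negbK orbC; have := cond b; rewrite bj andbT; case: leqP.
rewrite /arrive -/P e; apply/ffunP => k; rewrite !ffunE ltnS.
case: (eqVneq k j) => [->|kj]; first by rewrite leqnn.
have -> : (sigma k <= i)%N = (sigma k < i)%N.
  rewrite leq_eqVlt; have -> : (sigma k == i :> nat) = (k == j).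
    by rewrite (inj_eq val_inj) (inj_eq perm_inj).
  by rewrite (negPf kj).
by case: ifP.
Qed.

Lemma arriveP p (s : street n) i j :
  arrive p s i j = s j \/ s j = None /\ arrive p s i j = Some i.
Proof.
rewrite /arrive; case e : (seq.filter _ _) => [|k l]; first by left.
have [/andP[_ /eqP sk] _] := filter_enum_ordP e.
by rewrite ffunE; case: eqP => [->|]; [right|left].
Qed.

(** Parked cars never move, and a space filled later is filled by a later car: hence
    the final street determines all the intermediate ones. *)
Lemma foldl_arriveP p (s : street n) (l : seq 'I_n) j :
  foldl (arrive p) s l j = s j \/
  s j = None /\ exists2 c, c \in l & foldl (arrive p) s l j = Some c.
Proof.
elim: l s => [|i l IH] s /=; first by left.
have [->|[e [c cl ->]]] := IH (arrive p s i); last first.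
  right; split; last by exists c; rewrite // inE cl orbT.
  by case: (arriveP p s i j) => [<- //|[]].
case: (arriveP p s i j) => [->|[sj ->]]; first by left.
by right; split=> //; exists i; rewrite ?mem_head.
Qed.

Definition street_at p (k : nat) : street n :=
  foldl (arrive p) [ffun=> None] (take k (enum 'I_n)).

Lemma street_atS p i : street_at p i.+1 = arrive p (street_at p i) i.
Proof.
rewrite /street_at (take_nth i) ?size_enum_ord // foldl_rcons.
by rewrite nth_ord_enum.
Qed.

(** If the final street is that of sigma, then so is every intermediate one, so both
    directions reduce to the one-car statement [arrive_snapshot]. *)
Lemma final_snapshot p sigma :
  (final_street p == snapshot sigma n) =
  [forall j, reaches sigma j (p (sigma j))].
Proof.
have finalE : final_street p = street_at p n.
  by rewrite /street_at take_oversize ?size_enum_ord.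
apply/eqP/forallP => [fin j|cond].
  suff at_k k : street_at p k = snapshot sigma k.
    by rewrite -arrive_snapshot -!at_k street_atS.
  apply/ffunP => x; rewrite ffunE.
  have mem_take (c : 'I_n) : (c \in take k (enum 'I_n)) = (c < k)%N.
    rewrite -(mem_map val_inj) map_take val_enum_ord take_iota mem_iota /=.
    by rewrite leq_min ltn_ord andbT.
  have mem_drop (c : 'I_n) : (c \in drop k (enum 'I_n)) = ~~ (c < k)%N.
    rewrite -(mem_map val_inj) map_drop val_enum_ord drop_iota mem_iota /= -leqNgt.
    by apply/andP/idP => [[]|] //; split=> //; have := ltn_ord c; lia.
  have := foldl_arriveP p (street_at p k) (drop k (enum 'I_n)) x.
  rewrite -foldl_cat cat_take_drop -/(final_street p) fin ffunE ltn_ord.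
  have := foldl_arriveP p [ffun=> None] (take k (enum 'I_n)) x.
  rewrite -/(street_at p k) !ffunE => -[->|[_ [c + ->]]].
    case=> [//|[_ [c + [->]]]].
    by rewrite mem_drop => /negPf ->.
  by rewrite mem_take => ck [[->]|[]] //; rewrite ck.
rewrite finalE; suff at_k k : (k <= n)%N -> street_at p k = snapshot sigma k.
  exact: at_k.
elim: k => [_|k IH kn].
  by apply/ffunP => j; rewrite /street_at take0 !ffunE.
pose j := (sigma^-1)%g (Ordinal kn).
have sj : sigma j = Ordinal kn by rewrite permKV.
rewrite (street_atS p (Ordinal kn)) /= IH; last exact: ltnW.
by have := arrive_snapshot p sigma j; rewrite cond sj => /eqP.
Qed.

Lemma codom_ord0 sigma : n = 0%N -> codom sigma = [::].
Proof. by move=> n0; apply: size0nil; rewrite size_codom card_ord. Qed.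

Lemma nth_codom_ord sigma x0 j : nth x0 (codom sigma) j = sigma j.
Proof. by rewrite (nth_map j) ?size_enum_ord // nth_ord_enum. Qed.

Lemma card_reaches sigma j :
  #|[pred a | reaches sigma j a]| = suffixes_below (sigma j) (take j (codom sigma)).
Proof.
have szw : size (codom sigma) = n by rewrite size_codom card_ord.
have szt : size (take j (codom sigma)) = j by rewrite size_take szw ltn_ord.
rewrite suffixes_belowE szt.
rewrite (big_ord_widen n (fun a => nat_of_bool (all _ (drop a _)))) //.
rewrite -sum1_card big_mkcond [RHS]big_mkcond; apply: eq_bigr => a _.
rewrite inE /reaches ltnS; case: leqP => //= aj.
set b1 := [forall b, _]; set b2 := all _ _; suff -> : b1 = b2 by case: b2.
apply/forallP/(all_nthP j) => [h k|h b].
  rewrite size_drop szt => kj; rewrite nth_drop nth_take; last by lia.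
  have akn : (a + k < n)%N by have := ltn_ord j; lia.
  have := h (Ordinal akn); rewrite /= (nth_codom_ord _ _ (Ordinal akn)).
  by have -> : (a <= a + k < j)%N by lia.
apply/implyP => /andP[ab bj]; have := h (b - a)%N.
rewrite size_drop szt nth_drop nth_take; last by lia.
by rewrite subnKC // nth_codom_ord; apply; lia.
Qed.

(** By [final_snapshot] the fiber is a product of sets of admissible preferences,
    one for each car. *)
Lemma card_fiber sigma :
  #|[set p : parking_function n | T_park p == sigma]| =
  run_weight [::] (codom sigma).
Proof.
have T_parkP (p : parking_function n) :
    (T_park p == sigma) = (final_street (val p) == snapshot sigma n).
  apply/eqP/eqP => [<-|e].
    by apply/ffunP => j; rewrite T_parkE ffunE ltn_ord.
  apply/permP => j; have := T_parkE p j; rewrite e ffunE ltn_ord.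
  by case.
rewrite -(card_imset _ val_inj).
transitivity #|(family (fun i => [pred a | reaches sigma ((sigma^-1)%g i) a])
                : simpl_pred {ffun 'I_n -> 'I_n})|.
  apply: eq_card => p; apply/imsetP/familyP => [[q + ->] i|h].
    rewrite inE T_parkP final_snapshot => /forallP/(_ ((sigma^-1)%g i)).
    by rewrite permKV.
  have fin : final_street p == snapshot sigma n.
    rewrite final_snapshot; apply/forallP => j.
    by have := h (sigma j); rewrite inE permK.
  have park : is_parking p.
    apply/forallP => i; apply/existsP; exists ((sigma^-1)%g i).
    by rewrite (eqP fin) ffunE ltn_ord permKV.
  by exists (Sub p park); rewrite ?inE ?T_parkP.
rewrite card_family foldrE big_image /= (reindex_inj (@perm_inj _ sigma)) /=.
have [n0|n0] := posnP n.
  rewrite codom_ord0 // big1 // => j; by have := ltn_ord j; lia.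
rewrite (run_weightE (Ordinal n0)) size_codom card_ord; apply: eq_bigr => j _.
by rewrite permK card_reaches nth_codom_ord.
Qed.

Lemma X_LR_maxE sigma : X_LR_max sigma = records [::] (codom sigma).
Proof.
rewrite /X_LR_max -sum1_card big_mkcond /=.
have [n0|n0] := posnP n.
  by rewrite codom_ord0 // big1 // => j; have := ltn_ord j; lia.
pose x0 := Ordinal n0.
have szw : size (codom sigma) = n by rewrite size_codom card_ord.
rewrite (recordsE x0) szw; apply: eq_bigr => j _.
rewrite inE nth_codom_ord; set b1 := is_LR_max _ _; set b2 := all _ _.
suff -> : b1 = b2 by case: b2.
have szt : size (take j (codom sigma)) = j by rewrite size_take szw ltn_ord.
apply/forallP/(all_nthP x0) => [h k|h b].
  rewrite szt => kj; have km := ltn_trans kj (ltn_ord j).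
  have := h (Ordinal km); rewrite nth_take //= kj.
  by rewrite (nth_codom_ord _ _ (Ordinal km)).
by apply/implyP => bj; have := h b; rewrite szt nth_take // nth_codom_ord; apply.
Qed.

(** Passes from permutations to their words, where cutting at the maximum is
    concatenation. *)
Lemma sum_perm_codom (V : nmodType) (F : seq 'I_n -> V) :
  \sum_(sigma : 'S_n) F (codom sigma) =
  \sum_(s <- permutations (enum [set: 'I_n])) F s.
Proof.
have inj : injective (fun sigma : 'S_n => codom sigma).
  by move=> s t /eq_in_map e; apply/permP => i; apply: e; rewrite mem_enum.
have uniq_words : uniq [seq codom sigma | sigma : 'S_n].
  by rewrite map_inj_uniq ?enum_uniq.
have [_ words] : (size [seq codom sigma | sigma : 'S_n] =
    size (permutations (enum [set: 'I_n]))) *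
    ([seq codom sigma | sigma : 'S_n] =i permutations (enum [set: 'I_n])).
  apply: uniq_min_size => // [s /codomP[sigma ->]|].
    rewrite mem_permutations; apply: uniq_perm; rewrite ?enum_uniq //.
      by apply/injectiveP/perm_inj.
    move=> i; rewrite mem_enum finset.in_setT; apply/codomP.
    by exists ((sigma^-1)%g i); rewrite permKV.
  rewrite size_permutations ?enum_uniq // -cardE cardsT card_ord.
  by rewrite size_codom card_Sn.
rewrite -(perm_big _ (uniq_perm uniq_words (permutations_uniq _) words)).
by rewrite big_image.
Qed.

End Fibers.
(** * The mean number of left-to-right maxima *)

Lemma card_parking_function n :
  #|{: parking_function n}| =
  (\sum_(sigma : 'S_n) #|[set p : parking_function n | T_park p == sigma]|)%N.
Proof.
rewrite -sum1_card (partition_big (@T_park n) xpredT) //=.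
by apply: eq_bigr => sigma _; rewrite -sum1dep_card.
Qed.

Lemma parking_count_neq0 (R : numFieldType) n : parking_count R n != 0.
Proof. by rewrite mulf_neq0 ?invr_neq0 ?expf_neq0 ?pnatr_eq0. Qed.

Lemma E_park_LR_maxE (R : realType) n : E_park_LR_max R n = mean_records R n.
Proof.
have [sum_w sum_r] := sum_run_weight R [set: 'I_n].
rewrite cardsT card_ord -!sum_perm_codom in sum_w sum_r.
have cardPF : #|{: parking_function n}|%:R = parking_count R n.
  rewrite card_parking_function natr_sum -sum_w.
  by apply: eq_bigr => sigma _; rewrite card_fiber.
rewrite /E_park_LR_max /E_park.
apply: (mulfI (parking_count_neq0 R n)); rewrite -sum_r mulr_sumr.
apply: eq_bigr => sigma _.
rewrite /P_park cardPF card_fiber X_LR_maxE mulrCA [_ * (_ / _)]mulrC mulfVK //.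
exact: parking_count_neq0.
Qed.

Section MeanRecords.
Variable R : realFieldType.
Implicit Types n m M : nat.

Lemma prod_ffact n l :
  \prod_(0 <= j < l) (n%:R - j%:R) = (n ^_ l)%:R :> R.
Proof.
elim: l => [|l IH]; first by rewrite big_geq.
by rewrite big_nat_recr //= IH natr_ffactS.
Qed.

Lemma ffact_ratioS n m :
  ffact_ratio R n m.+1 = ffact_ratio R n m * (n%:R - m%:R) / n.+1%:R.
Proof. by rewrite /ffact_ratio natr_ffactS exprSr invfM; ring. Qed.

(** The telescoping relation behind both the summation by parts and the bounds. *)
Lemma ffact_ratio_decr n m :
  ffact_ratio R n m - ffact_ratio R n m.+1 =
  ffact_ratio R n m * m.+1%:R / n.+1%:R.
Proof.
rewrite ffact_ratioS; have : n.+1%:R != 0 :> R by rewrite pnatr_eq0.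
by rewrite -(natr1 n) -(natr1 m) => n0; field.
Qed.

Lemma ffact_ratio_large n m : (n < m)%N -> ffact_ratio R n m = 0.
Proof. by move=> nm; rewrite /ffact_ratio ffact_small // mul0r. Qed.

(** Summation by parts: with q_l = [ffact_ratio R n l], the terms of the two sums add
    up to (n+1) (q_l / l - q_(l+1) / (l+1)), and these telescope to (n+1) q_1 = n. *)
Lemma mean_recordsE n :
  mean_records R n =
  n%:R - \sum_(1 <= l < n.+1) (n%:R - l%:R) / (l%:R * (l%:R + 1))
           * ((\prod_(0 <= j < l) (n%:R - j%:R)) / (n%:R + 1) ^+ l).
Proof.
apply/eqP; rewrite eq_sym subr_eq eq_sym; apply/eqP.
rewrite /mean_records -big_split /=.
pose h l : R := - (n.+1%:R * ffact_ratio R n l / l%:R).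
transitivity (\sum_(1 <= l < n.+1) (h l.+1 - h l)); last first.
  rewrite telescope_sumr // /h ffact_ratio_large // mulr0 mul0r oppr0 sub0r opprK.
  rewrite /ffact_ratio ffactn1 expr1 divr1; field; rewrite addrC natr1.
  by rewrite pnatr_eq0.
apply: eq_big_nat => l /andP[l0 _].
rewrite prod_ffact (natr1 n) -/(ffact_ratio R n l) /h ffact_ratioS.
have : n.+1%:R != 0 :> R by rewrite pnatr_eq0.
have : l.+1%:R != 0 :> R by rewrite pnatr_eq0.
have : l%:R != 0 :> R by rewrite pnatr_eq0 -lt0n.
move: (ffact_ratio R n l) => q.
rewrite -(natr1 n) -(natr1 l) => l00 l10 n10.
by field; rewrite l00 l10.
Qed.

Lemma ffact_ratio_ge0 n m : 0 <= ffact_ratio R n m.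
Proof. by rewrite divr_ge0 ?exprn_ge0 ?ler0n. Qed.

Lemma ffact_ratio_nonincr n m : ffact_ratio R n m.+1 <= ffact_ratio R n m.
Proof.
rewrite -subr_ge0 ffact_ratio_decr divr_ge0 ?ler0n //.
by rewrite mulr_ge0 ?ffact_ratio_ge0 ?ler0n.
Qed.

Lemma ffact_ratio_le1 n m : ffact_ratio R n m <= 1.
Proof.
elim: m => [|m]; first by rewrite /ffact_ratio ffactn0 expr0 divr1.
exact/le_trans/ffact_ratio_nonincr.
Qed.

(** By [ffact_ratio_decr] each step loses at most (m+1) / (n+1). *)
Lemma ffact_ratio_ge n m :
  1 - (m * m.+1)%:R / (2 * n.+1%:R) <= ffact_ratio R n m.
Proof.
have n0 : 0 < n.+1%:R :> R by rewrite ltr0n.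
elim: m => [|m IH].
  by rewrite mul0n mul0r subr0 /ffact_ratio ffactn0 expr0 divr1.
have le_step : ffact_ratio R n m * m.+1%:R / n.+1%:R <= m.+1%:R / n.+1%:R.
  rewrite ler_pM2r ?invr_gt0 // -[leRHS]mul1r ler_pM2r ?ltr0n //.
  exact: ffact_ratio_le1.
have -> : (m.+1 * m.+2)%:R / (2 * n.+1%:R) =
    (m * m.+1)%:R / (2 * n.+1%:R) + m.+1%:R / n.+1%:R :> R.
  rewrite !natrM -(natr1 m.+1) -(natr1 m).
  by field; rewrite addrC natr1 gt_eqF.
have := ffact_ratio_decr n m; move: IH le_step.
move: (_ * _ / n.+1%:R) (m.+1%:R / _) (_%:R / _) => a b c; lra.
Qed.

(** For m <= M the terms are at most 1; for m > M, [ffact_ratio_decr] bounds a term by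
    (n+1)/(M+1) times the decrease to the next one. *)
Lemma sum_ffact_ratio_le n M : (M <= n)%N ->
  \sum_(1 <= m < n.+1) ffact_ratio R n m <= M%:R + n.+1%:R / M.+1%:R.
Proof.
move=> Mn; rewrite (big_cat_nat (n := M.+1)) //= lerD //.
  apply: le_trans (_ : \sum_(1 <= m < M.+1) (1 : R) <= _).
    by apply: ler_sum => m _; apply: ffact_ratio_le1.
  by rewrite sumr_const_nat subn1.
apply: (@le_trans _ _ (\sum_(M.+1 <= m < n.+1) n.+1%:R / M.+1%:R *
    - (ffact_ratio R n m.+1 - ffact_ratio R n m))).
  apply: ler_sum_nat => m /andP[Mm _].
  have -> : n.+1%:R / M.+1%:R * - (ffact_ratio R n m.+1 - ffact_ratio R n m) =
            ffact_ratio R n m * (m.+1%:R / M.+1%:R).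
    rewrite opprB ffact_ratio_decr.
    have : n.+1%:R != 0 :> R by rewrite pnatr_eq0.
    have : M.+1%:R != 0 :> R by rewrite pnatr_eq0.
    move: n.+1%:R M.+1%:R m.+1%:R (ffact_ratio R n m) => z a b q a0 z0.
    by field; rewrite a0 z0.
  by rewrite ler_peMr ?ffact_ratio_ge0 // ler_pdivlMr ?ltr0n // mul1r ler_nat ltnW.
rewrite -mulr_sumr sumrN telescope_sumr // [ffact_ratio R n n.+1]ffact_ratio_large //.
by rewrite sub0r opprK -[leRHS]mulr1 ler_wpM2l ?ffact_ratio_le1 // divr_ge0 ?ler0n.
Qed.

Lemma mean_records_le n M : (M <= n)%N ->
  mean_records R n <= 2 * (M%:R + n.+1%:R / M.+1%:R).
Proof.
move=> Mn; apply: le_trans (ler_wpM2l _ (sum_ffact_ratio_le Mn)) => //.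
rewrite mulr_sumr /mean_records.
apply: ler_sum_nat => m /andP[m0 _]; rewrite ler_wpM2r ?ffact_ratio_ge0 //.
rewrite ler_pdivrMr ?ltr0n // mulr_natl mulr2n lerD2l.
by rewrite ler1n.
Qed.

(** While m^2 <= n, [ffact_ratio_ge] keeps every term at least 1/4, because
    m (m + 1) <= n + (n + 1) / 2. *)
Lemma mean_records_ge n M : (0 < M)%N -> (M * M <= n)%N ->
  M%:R / 4 <= mean_records R n.
Proof.
move=> M0 MMn; have Mn : (M <= n)%N by nia.
rewrite /mean_records (big_cat_nat (n := M.+1)) //=.
rewrite -[leLHS]addr0 lerD //; last first.
  apply: sumr_ge0 => m _; apply: mulr_ge0 (ffact_ratio_ge0 _ _).
  by rewrite natr1 divr_ge0 ?ler0n.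
have -> : M%:R / 4 = \sum_(1 <= m < M.+1) (4^-1 : R).
  by rewrite sumr_const_nat subn1 mulr_natl.
apply: ler_sum_nat => m /andP[m0 mM].
apply: le_trans (_ : ffact_ratio R n m <= _); last first.
  rewrite ler_peMl ?ffact_ratio_ge0 // ler_pdivlMr ?ltr0n // mul1r lerDl //.
apply: le_trans (ffact_ratio_ge n m).
have le34 : (m * m.+1)%:R / (2 * n.+1%:R) <= 3 / 4 :> R.
  rewrite ler_pdivrMr ?mulr_gt0 ?ltr0n //.
  have : (2 * (m * m.+1) <= 3 * n.+1)%N by nia.
  rewrite -(ler_nat R) !natrM; move: (m%:R * _) (n.+1%:R) => a b; lra.
move: (_ / _) le34 => a; lra.
Qed.

End MeanRecords.

(** * Order of magnitude *)

Section Asymptotics.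
Variable R : realType.

Lemma natr_sqrt_bounds (n : nat) : (0 < n)%N ->
  exists M : nat, [/\ (0 < M)%N, (M * M <= n)%N,
    M%:R <= Num.sqrt n%:R :> R & Num.sqrt n%:R < M.+1%:R :> R].
Proof.
move=> n0; set s : R := Num.sqrt n%:R.
have s0 : 0 <= s by exact: sqrtr_ge0.
have s2 : s * s = n%:R by rewrite -expr2 sqr_sqrtr // ler0n.
have /andP[Ms sM] := truncn_itv s0.
exists (Num.truncn s); split=> //.
  by rewrite truncn_gt0 -[leLHS]sqrtr1 ler_sqrt ?ler1n ?ltr0n.
by rewrite -(ler_nat R) natrM -s2 ler_pM ?ler0n.
Qed.

Lemma mean_records_le_sqrt (n : nat) : (0 < n)%N ->
  mean_records R n <= 6 * Num.sqrt n%:R.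
Proof.
move=> n0; have [M [M0 MMn Ms sM]] := natr_sqrt_bounds n0.
have Mn : (M <= n)%N by nia.
apply: le_trans (mean_records_le R Mn) _.
have s1 : 1 <= Num.sqrt n%:R :> R by rewrite -[leLHS]sqrtr1 ler_sqrt ?ler1n ?ltr0n.
have s2 : n%:R = Num.sqrt n%:R * Num.sqrt n%:R :> R by rewrite -expr2 sqr_sqrtr // ler0n.
have : n.+1%:R / M.+1%:R <= 2 * Num.sqrt n%:R :> R.
  rewrite ler_pdivrMr ?ltr0n // -(natr1 n) {1}s2.
  move: (Num.sqrt _) (M.+1%:R) s1 sM => s b s1 sb.
  have ss1 : 1 <= s * s by rewrite -[leLHS]mulr1 ler_pM.
  have ssb : s * s <= s * b by rewrite ler_wpM2l ?ltW // (lt_le_trans _ s1).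
  by rewrite -mulrA; lra.
move: (_ / _) (Num.sqrt _) (M%:R) Ms => a s b; lra.
Qed.

Lemma mean_records_ge_sqrt (n : nat) : (0 < n)%N ->
  Num.sqrt n%:R / 8 <= mean_records R n.
Proof.
move=> n0; have [M [M0 MMn Ms sM]] := natr_sqrt_bounds n0.
apply: le_trans (mean_records_ge R M0 MMn).
have : 1 <= M%:R :> R by rewrite ler1n.
move: sM; rewrite -natr1; move: (Num.sqrt _) (M%:R) => s b; lra.
Qed.

Lemma limn_esup_mean_records (eps : R) : 0 < eps ->
  limn_esup (fun n : nat => (mean_records R n / n%:R `^ (2^-1 + eps))%:E) = 0%E.
Proof.
move=> eps0.
suff cvg0 : ((fun n : nat => (mean_records R n / n%:R `^ (2^-1 + eps))%:E) @ \oo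
    --> 0%E)%classic by have [_ ->] := cvg_limn_einf_sup cvg0.
apply: cvg_EFin; first by apply: nearW.
apply/cvgr0Pnorm_lt => e e0.
(* Beyond this index 6 / n^eps < e. *)
exists (Num.truncn ((6 / e) `^ eps^-1)).+1 => // n /= Kn.
have n0 : (0 < n)%N by apply: leq_trans Kn.
have n0R : 0 < n%:R :> R by rewrite ltr0n.
have big_n : 6 / e < n%:R `^ eps.
  have e6 : 0 <= 6 / e by rewrite divr_ge0 // ltW.
  have -> : 6 / e = ((6 / e) `^ eps^-1) `^ eps.
    by rewrite -powRrM mulVf ?gt_eqF // powRr1.
  apply: gt0_ltr_powR => //; rewrite ?nnegrE ?powR_ge0 ?ler0n //.
  apply: lt_le_trans (_ : (Num.truncn ((6 / e) `^ eps^-1)).+1%:R <= _).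
    by have /andP[] := truncn_itv (powR_ge0 (6 / e) eps^-1).
  by rewrite ler_nat.
have sqrt0 : 0 < Num.sqrt n%:R :> R by rewrite sqrtr_gt0.
have pow0 : 0 < n%:R `^ eps :> R by exact: powR_gt0.
have mean0 : 0 <= mean_records R n.
  apply: le_trans (mean_records_ge_sqrt n0); rewrite divr_ge0 // ltW //.
rewrite powRD; last by rewrite (gt_eqF n0R) implybT.
rewrite powR12_sqrt ?ler0n // ger0_norm; last first.
  by rewrite divr_ge0 // mulr_ge0 // ltW.
rewrite ltr_pdivrMr ?mulr_gt0 //; apply: le_lt_trans (mean_records_le_sqrt n0) _.
move: big_n; rewrite ltr_pdivrMr // => big_n.
by rewrite mulrCA [6 * _]mulrC ltr_pM2l // mulrC.
Qed.

Lemma limn_einf_mean_records :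
  (0 < limn_einf (fun n : nat => (mean_records R n / n%:R `^ 2^-1)%:E))%E.
Proof.
apply: (@lt_le_trans _ _ (8^-1)%:E); first by rewrite lte_fin invr_gt0.
rewrite limn_einf_lim; apply: lime_ge; first exact: is_cvg_einfs.
exists 1%N => // n /= n0.
apply: le_ereal_inf_tmp => _ [k /= nk <-].
have k0 : (0 < k)%N by apply: leq_trans nk.
rewrite lee_fin powR12_sqrt ?ler0n // ler_pdivlMr ?sqrtr_gt0 ?ltr0n //.
by rewrite mulrC; exact: mean_records_ge_sqrt.
Qed.

End Asymptotics.

Theorem theorem6 (R : realType) :
  (forall n : nat, (0 < n)%N ->
     E_park_LR_max R n =
       n%:R - \sum_(1 <= l < n.+1)
                (n%:R - l%:R) / (l%:R * (l%:R + 1))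
                * ((\prod_(0 <= j < l) (n%:R - j%:R)) / (n%:R + 1) ^+ l))
  /\
  ((forall eps : R, 0 < eps ->
      limn_esup (fun n : nat =>
        (E_park_LR_max R n / n%:R `^ (2^-1 + eps))%:E) = 0%E)
   /\
   (0 < limn_einf (fun n : nat =>
        (E_park_LR_max R n / n%:R `^ 2^-1)%:E))%E).
Proof.
have E_mean : E_park_LR_max R = mean_records R.
  by apply/funext => n; exact: E_park_LR_maxE.
rewrite E_mean; split; first by move=> n _; exact: mean_recordsE.
by split; [exact: limn_esup_mean_records|exact: limn_einf_mean_records].
Qed.
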